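(* Let $\mathcal{A}\subseteq\mathcal{B}$ be sub-$\sigma$-algebras of a complete probability space $(\Omega,\mathcal{F},P)$. Let $x:L_\infty(\mathcal{B})\to L_\infty(\mathcal{A})$ be an $\mathcal{A}$-homogeneous monotone linear operator that is continuous from above, and assume there is a constant $c>0$ with $x(1)\ge c$. Then there is a probability measure $Q\ll P$ on $(\Omega,\mathcal{B})$, with $f:=\frac{dQ}{dP}\in L^+_1(\mathcal{B})$, such that \[x(X)=x(1)E_Q[X\mid\mathcal{A}]=x(1)E\Big[X\frac{f}{E[f\mid\mathcal{A}]}\,\Big|\,\mathcal{A}\Big],\qquad X\in L_\infty(\mathcal{B}).\] Moreover, there is a unique $f=\frac{dQ}{dP}$ in $L^+_1(\mathcal{B})$ such that $E[f\mid\mathcal{A}]=1$ and $x(X)=x(1)E[fX\mid\mathcal{A}]$.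
   Context: All (in)equalities hold $P$-a.s. $\mathcal{A}$-homogeneous: $x(\lambda X)=\lambda x(X)$ for all $\lambda\in L^+_\infty(\mathcal{A})$, $X\in L_\infty(\mathcal{B})$. Monotone: $X\ge X'\Rightarrow x(X)\ge x(X')$. Continuous from above: for every nonincreasing sequence $X_n$ with $P$-a.s. limit $X$, $x(X_n)\downarrow x(X)$ $P$-a.s. *)

(* Defs.v *)
From HB Require Import structures.
From mathcomp Require Import all_boot all_order all_algebra.
From mathcomp Require Import all_classical all_reals all_analysis.
Set Implicit Arguments. Unset Strict Implicit. Unset Printing Implicit Defensive.
Import Order.TTheory GRing.Theory Num.Theory.
Import numFieldNormedType.Exports.
Local Open Scope classical_set_scope.
Local Open Scope ring_scope.

Section defs.
Context {d : measure_display} {T : measurableType d} {R : realType}.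

Definition sub_sigma (A : set (set T)) : Prop :=
  sigma_algebra setT A /\ A `<=` measurable.

Definition meas_wrt (A : set (set T)) (f : T -> R) : Prop :=
  forall S : set R, measurable S -> A (f @^-1` S).

Definition Linf (P : {measure set T -> \bar R}) (A : set (set T)) (X : T -> R) : Prop :=
  meas_wrt A X /\ exists M : R, {ae P, forall t, `|X t| <= M}.

Definition L1plus (P : {measure set T -> \bar R}) (A : set (set T)) (f : T -> R) : Prop :=
  [/\ meas_wrt A f, P.-integrable setT (EFin \o f) & {ae P, forall t, 0 <= f t}].

Definition is_cond_exp (mu : {measure set T -> \bar R}) (A : set (set T))
    (X Y : T -> R) : Prop :=
  [/\ mu.-integrable setT (EFin \o X), meas_wrt A Y,
      mu.-integrable setT (EFin \o Y) &
      forall G, A G ->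
        (\int[mu]_(t in G) (Y t)%:E = \int[mu]_(t in G) (X t)%:E)%E].

(* properties of the operator x : L_infty(B) -> L_infty(A), given on
   representatives; all (in)equalities hold P-a.s. *)
Definition op_maps (P : {measure set T -> \bar R}) (A B : set (set T))
    (x : (T -> R) -> T -> R) : Prop :=
  forall X, Linf P B X -> Linf P A (x X).

Definition op_respects_ae (P : {measure set T -> \bar R}) (B : set (set T))
    (x : (T -> R) -> T -> R) : Prop :=
  forall X X', Linf P B X -> Linf P B X' -> X = X' %[ae P] -> x X = x X' %[ae P].

Definition op_linear (P : {measure set T -> \bar R}) (B : set (set T))
    (x : (T -> R) -> T -> R) : Prop :=
  forall (a b : R) X Y, Linf P B X -> Linf P B Y ->
    x (fun t => a * X t + b * Y t) = (fun t => a * x X t + b * x Y t) %[ae P].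

Definition op_homogeneous (P : {measure set T -> \bar R}) (A B : set (set T))
    (x : (T -> R) -> T -> R) : Prop :=
  forall lam X, Linf P A lam -> {ae P, forall t, 0 <= lam t} -> Linf P B X ->
    x (fun t => lam t * X t) = (fun t => lam t * x X t) %[ae P].

Definition op_monotone (P : {measure set T -> \bar R}) (B : set (set T))
    (x : (T -> R) -> T -> R) : Prop :=
  forall X X', Linf P B X -> Linf P B X' ->
    {ae P, forall t, X' t <= X t} -> {ae P, forall t, x X' t <= x X t}.

Definition op_cont_above (P : {measure set T -> \bar R}) (B : set (set T))
    (x : (T -> R) -> T -> R) : Prop :=
  forall (Xn : nat -> T -> R) (X : T -> R),
    (forall n, Linf P B (Xn n)) -> Linf P B X ->
    {ae P, forall t, (forall n, Xn n.+1 t <= Xn n t) /\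
                     (fun n => Xn n t) @ \oo --> X t} ->
    {ae P, forall t, (forall n, x (Xn n.+1) t <= x (Xn n) t) /\
                     (fun n => x (Xn n) t) @ \oo --> x X t}.

End defs.

(* Main.v *)
(** Write [u := x 1].  The real functional [phi X := E[x X / u]] is linear,
positive and continuous from above, so [G |-> phi 1_G] is a finite measure on
[B] that is absolutely continuous with respect to [P]; its Radon-Nikodym density
[f] satisfies [phi X = E[f X]] for every bounded [X].  Applying this to [1_H X]
with [H] in [A], homogeneity of [x] gives [E[1_H x X / u] = E[1_H f X]], that is,
[x X / u = E[f X | A]].  In particular [E[f | A] = 1], so that [dQ = f dP]
agrees with [P] on [A] and conditional expectations under [Q] become
conditional expectations of [f X] under [P].  Conversely [f] is unique because
[E[f 1_G] = E[x 1_G / u]] for every [G] in [B]. *)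

Require Import Defs.
From HB Require Import structures.
From mathcomp Require Import all_boot all_order all_algebra.
From mathcomp Require Import all_classical all_reals all_analysis measurable_realfun ring lra.
Import Order.TTheory GRing.Theory Num.Theory.
Import numFieldNormedType.Exports.
Local Open Scope classical_set_scope.
Local Open Scope ring_scope.

Set Implicit Arguments.
Unset Strict Implicit.
Unset Printing Implicit Defensive.

(** * Measures and integrals restricted to a sub-sigma-algebra *)

Section trace.
Context {d : measure_display} {T : measurableType d} {R : realType}.
Context {A : set (set T)} (sA : sub_sigma A).
Implicit Types (f g : T -> R) (mu nu : {measure set T -> \bar R}).

Local Notation TA := (g_sigma_algebraType A).

(** A sigma-algebra generates itself, so [TA] is [T] with exactly the sets of [A] measurable;
    results on measurable spaces thereby become available for [A]. *)
Lemma trace_measurableE : (measurable : set (set TA)) = A.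
Proof. by apply: sigma_algebra_id; case: sA. Qed.

Lemma meas_wrtP f : meas_wrt A f <-> measurable_fun setT (f : TA -> R).
Proof.
split=> [mf _ S mS|mf S mS].
  by rewrite setTI trace_measurableE; exact: mf.
by rewrite -trace_measurableE -[f @^-1` S]setTI; exact: mf.
Qed.

Lemma sub_sigma_measurable G : A G -> measurable G.
Proof. by case: sA => _; exact. Qed.

Lemma meas_wrt_measurable f : meas_wrt A f -> measurable_fun setT f.
Proof. by move=> mf _ S mS; rewrite setTI; exact/sub_sigma_measurable/mf. Qed.

Lemma sub_sigmaT : A setT.
Proof. by rewrite -trace_measurableE; exact: measurableT. Qed.

Lemma measurable_to_trace : measurable_fun setT (idfun : T -> TA).
Proof.
by move=> _ S; rewrite trace_measurableE setTI => /sub_sigma_measurable.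
Qed.

(* The proof argument only serves the inference of the measure structure. *)
Definition trace_measure mu (s : sub_sigma A) : set TA -> \bar R := mu.

Let trace0 mu : trace_measure mu sA set0 = 0%E.
Proof. exact: measure0. Qed.

Let trace_ge0 mu G : (0 <= trace_measure mu sA G)%E.
Proof. exact: measure_ge0. Qed.

Let trace_sigma_additive mu : semi_sigma_additive (trace_measure mu sA).
Proof.
move=> F mF tF mUF; apply: measure_semi_sigma_additive => //.
- by move=> i; apply: sub_sigma_measurable; rewrite -trace_measurableE.
- by apply: sub_sigma_measurable; rewrite -trace_measurableE.
Qed.

HB.instance Definition _ mu := isMeasure.Build _ _ _
  (trace_measure mu sA) (trace0 mu) (trace_ge0 mu) (@trace_sigma_additive mu).

(** The trace of [mu] is its push-forward along the identity from [T] to [TA], so a change of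
    variables equates the two integrals of the absolute value. *)
Lemma integrable_trace mu f : meas_wrt A f ->
  mu.-integrable setT (EFin \o f) <->
  (trace_measure mu sA).-integrable setT (EFin \o f).
Proof.
move=> mf; have mf' : measurable_fun setT (fun t : TA => (f t)%:E).
  by apply/measurable_EFinP/meas_wrtP.
have E : (\int[trace_measure mu sA]_t `|(f t)%:E| = \int[mu]_t `|(f t)%:E|)%E.
  have := @ge0_integral_pushforward _ _ T TA R idfun measurable_to_trace mu
    setT (fun t => `|(f t)%:E|)%E measurableT _ _.
  apply=> //; exact: measurableT_comp.
split=> /integrableP[_ fi]; apply/integrableP; split=> //.
- by rewrite /= E.
- exact/measurable_EFinP/meas_wrt_measurable.
- by rewrite /= -E.
Qed.

Lemma integral_trace mu f G : meas_wrt A f -> A G ->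
  mu.-integrable setT (EFin \o f) ->
  (\int[trace_measure mu sA]_(t in G) (f t)%:E = \int[mu]_(t in G) (f t)%:E)%E.
Proof.
move=> mf AG fi.
apply: (@integral_pushforward _ _ T TA R idfun measurable_to_trace mu G
  (EFin \o f)).
- by apply/measurable_EFinP/meas_wrtP.
- by apply: integrableS fi => //; exact: sub_sigma_measurable.
- by rewrite trace_measurableE.
Qed.

Lemma ae_trace mu (S : set T) :
  {ae trace_measure mu sA, forall t : TA, S t} -> {ae mu, forall t, S t}.
Proof.
move=> [N [mN N0 sub]]; exists N; split=> //.
by apply: sub_sigma_measurable; rewrite -trace_measurableE.
Qed.

(** On the trace space the sets of [A] are all the measurable sets, so equal integrals over them
    force a.e. equality there; a null set in [A] is also null for [mu]. *)
Lemma meas_wrt_ae_eq mu f g : meas_wrt A f -> meas_wrt A g ->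
  mu.-integrable setT (EFin \o f) -> mu.-integrable setT (EFin \o g) ->
  (forall G, A G ->
    \int[mu]_(t in G) (f t)%:E = \int[mu]_(t in G) (g t)%:E)%E ->
  f = g %[ae mu].
Proof.
move=> mf mg fi gi fg.
have : ae_eq (trace_measure mu sA) setT (EFin \o f) (EFin \o g).
  apply: integral_ae_eq => //.
  - exact/integrable_trace.
  - exact/measurable_EFinP/meas_wrtP.
  - move=> G _; rewrite trace_measurableE => AG.
    by rewrite /= !integral_trace// fg.
move=> /ae_trace fg'.
have {}fg' : EFin \o f = EFin \o g %[ae mu] := fg'.
move: fg'; by apply: filterS => t /= /[apply] -[].
Qed.

(** The two measures have the same trace on [A], and the trace alone determines the integrals of
    [f]. This moves conditional expectations from [Q] to [P]. *)
Lemma eq_measure_meas_wrt mu nu f : meas_wrt A f ->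
  (forall G, A G -> mu G = nu G) -> mu.-integrable setT (EFin \o f) ->
  nu.-integrable setT (EFin \o f) /\
  (forall G, A G ->
    \int[nu]_(t in G) (f t)%:E = \int[mu]_(t in G) (f t)%:E)%E.
Proof.
move=> mf munu fi.
have E (h : TA -> \bar R) G : (\int[trace_measure nu sA]_(t in G) h t =
    \int[trace_measure mu sA]_(t in G) h t)%E.
  apply: eq_measure_integral => S; rewrite trace_measurableE => AS _.
  exact/esym/munu.
have fn : nu.-integrable setT (EFin \o f).
  have /integrable_trace/integrableP[//|mf' fi'] := fi.
  by apply/integrable_trace => //; apply/integrableP; split=> //; rewrite E.
by split=> // G AG; rewrite -!integral_trace// E.
Qed.

(** Radon-Nikodym on the trace space, which makes the density measurable for [A] itself. Here [nu]
    is a mere set function, additive on [A]; nonnegativity is asked on every set because the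
    structure of measure demands it. *)
Lemma radon_nikodym_trace (mu : {finite_measure set T -> \bar R})
    (nu : set T -> \bar R) :
  nu set0 = 0%E -> (forall G, (0 <= nu G)%E) -> nu setT \is a fin_num ->
  (forall F : nat -> set T, (forall n, A (F n)) -> trivIset setT F ->
    (fun n => \sum_(0 <= i < n) nu (F i))%E @ \oo --> nu (\bigcup_n F n)) ->
  (forall G, A G -> mu G = 0%E -> nu G = 0%E) ->
  exists f : T -> R, [/\ forall t, 0 <= f t, meas_wrt A f,
    mu.-integrable setT (EFin \o f) &
    forall G, A G -> nu G = (\int[mu]_(t in G) (f t)%:E)%E].
Proof.
move=> nu0 nu_ge0 nufin nuS numu.
have nuA : @semi_sigma_additive _ R TA nu.
  by move=> F mF tF _; apply: nuS => // n; rewrite -trace_measurableE.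
pose nu' : {measure set TA -> \bar R} :=
  HB.pack nu (isMeasure.Build _ _ _ (nu : set TA -> \bar R) nu0 nu_ge0 nuA).
have nu'fin : fin_num_fun nu'.
  apply: lty_fin_num_fun; rewrite ltey_eq; apply/orP; left; exact: nufin.
pose nu'' : {finite_measure set TA -> \bar R} :=
  HB.pack (nu : set TA -> \bar R) (Measure.on nu')
    (Measure_isFinite.Build _ _ _ nu' nu'fin).
pose m' : {measure set TA -> \bar R} := trace_measure mu sA.
have m'fin : fin_num_fun m'.
  by apply: lty_fin_num_fun; rewrite ltey_eq; apply/orP; left; exact: fin_num_measure.
pose m : {finite_measure set TA -> \bar R} :=
  HB.pack (trace_measure mu sA) (Measure.on m')
    (Measure_isFinite.Build _ _ _ m' m'fin).
have dom : nu'' `<< m.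
  apply/null_content_dominatesP => G; rewrite trace_measurableE; exact: numu.
have [g [g0 gfin gi gE]] := radon_nikodym_sigma_finite dom.
pose f t := fine (g t).
have fg : EFin \o f = g by apply/funext => t /=; rewrite fineK.
have mf : meas_wrt A f.
  by apply/meas_wrtP/measurable_EFinP; rewrite fg; case/integrableP: gi.
have fi : mu.-integrable setT (EFin \o f) by apply/integrable_trace; rewrite ?fg.
exists f; split=> //; first by move=> t; exact: fine_ge0.
move=> G AG; rewrite -integral_trace//.
have := gE G; rewrite trace_measurableE => /(_ AG).
by rewrite -fg.
Qed.

End trace.

(** * Integrability and integrals under almost everywhere relations *)

Section almost_everywhere_integrals.
Context {d : measure_display} {T : measurableType d} {R : realType}.
Implicit Types (f g h : T -> R) (mu : {measure set T -> \bar R}).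

Lemma measurable_fun_invr f :
  measurable_fun setT f -> measurable_fun setT (fun t => (f t)^-1).
Proof.
(* Squaring makes the base of the real power nonnegative; where [f] vanishes both sides are 0, since
   the inverse of 0 is 0. *)
move=> mf; rewrite (_ : (fun t => _) = f \* (fun t => (f t ^+ 2) `^ (-1))).
  apply: measurable_funM => //.
  apply: (measurableT_comp (measurable_powR _)); exact: measurable_funX.
apply/funext => t /=; rewrite powR_inv1 ?sqr_ge0//.
have [->|f0] := eqVneq (f t) 0; first by rewrite invr0 mul0r.
by rewrite expr2 invfM mulrA divff// mul1r.
Qed.

Lemma ae_le_integrable mu f g : measurable_fun setT g ->
  {ae mu, forall t, `|g t| <= `|f t|} -> mu.-integrable setT (EFin \o f) ->
  mu.-integrable setT (EFin \o g).
Proof.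
move=> mg gf /integrableP[mf fi]; have mg' : measurable_fun setT (EFin \o g).
  exact/measurable_EFinP.
apply/integrableP; split=> //; apply: le_lt_trans fi.
apply: ae_ge0_le_integral => //; [exact: measurableT_comp..|].
by move: gf; apply: filterS => t gft _; rewrite /= lee_fin.
Qed.

Lemma eq_ae_integrable mu f g : measurable_fun setT g -> f = g %[ae mu] ->
  mu.-integrable setT (EFin \o f) -> mu.-integrable setT (EFin \o g).
Proof.
move=> mg fg; apply: ae_le_integrable => //.
by move: fg; apply: filterS => t ->.
Qed.

Lemma eq_ae_integral mu f g G : measurable G -> measurable_fun setT f ->
  measurable_fun setT g -> f = g %[ae mu] ->
  (\int[mu]_(t in G) (f t)%:E = \int[mu]_(t in G) (g t)%:E)%E.
Proof.
move=> mG mf mg fg; apply: ae_eq_integral => //.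
- exact/measurable_funTS/measurable_EFinP.
- exact/measurable_funTS/measurable_EFinP.
- by move: fg; apply: filterS => t fgt _; rewrite fgt.
Qed.

Lemma integral_indicM mu f G :
  (\int[mu]_t (\1_G t * f t)%:E = \int[mu]_(t in G) (f t)%:E)%E.
Proof.
rewrite [RHS]integral_mkcond; apply: eq_integral => t _.
by rewrite epatch_indic/= EFinM muleC.
Qed.

End almost_everywhere_integrals.

(** * Essentially bounded functions and their products with integrable ones *)

Section bounded_functions.
Context {d : measure_display} {T : measurableType d} {R : realType}.
Context {mu : {finite_measure set T -> \bar R}}.
Context {A : set (set T)} (sA : sub_sigma A).
Implicit Types X Y f : T -> R.

Lemma Linf_measurable X : Linf mu A X -> measurable_fun setT X.
Proof. by move=> [/(meas_wrt_measurable sA)]. Qed.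

Lemma Linf_le X Y : meas_wrt A X ->
  {ae mu, forall t, `|X t| <= `|Y t|} -> Linf mu A Y -> Linf mu A X.
Proof.
move=> mX XY [_ [M YM]]; split=> //; exists M.
by move: XY YM; apply: filterS2 => t; exact: le_trans.
Qed.

Lemma Linf_cst (r : R) : Linf mu A (fun=> r).
Proof.
split; last by exists `|r|; exact: aeW.
exact/(meas_wrtP sA)/measurable_cst.
Qed.

Lemma Linf_indic G : A G -> Linf mu A \1_G.
Proof.
move=> AG; split; last first.
  by exists 1; apply: aeW => t; rewrite indicE; case: (_ \in _); rewrite ?normr1 ?normr0.
by apply/(meas_wrtP sA)/measurable_indic; rewrite (trace_measurableE sA).
Qed.

Lemma Linf_lin (a b : R) X Y : Linf mu A X -> Linf mu A Y ->
  Linf mu A (fun t => a * X t + b * Y t).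
Proof.
move=> [/(meas_wrtP sA) mX [M XM]] [/(meas_wrtP sA) mY [N YN]]; split.
  by apply/(meas_wrtP sA); apply: measurable_funD; apply: measurable_funM.
exists (`|a| * M + `|b| * N); move: XM YN; apply: filterS2 => t XM YN.
by rewrite (le_trans (ler_normD _ _))// lerD// normrM ler_wpM2l.
Qed.

Lemma LinfM X Y : Linf mu A X -> Linf mu A Y -> Linf mu A (fun t => X t * Y t).
Proof.
move=> [/(meas_wrtP sA) mX [M XM]] [/(meas_wrtP sA) mY [N YN]]; split.
  by apply/(meas_wrtP sA); apply: measurable_funM.
exists (M * N); move: XM YN; apply: filterS2 => t XM YN.
by rewrite normrM ler_pM.
Qed.

Lemma integrable_LinfM f X : mu.-integrable setT (EFin \o f) ->
  Linf mu A X -> mu.-integrable setT (EFin \o (fun t => f t * X t)).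
Proof.
move=> fi LX; have mX := Linf_measurable LX; case: LX => _ [M XM].
have mf : measurable_fun setT f by case/integrableP: fi => /measurable_EFinP.
apply: (@ae_le_integrable _ _ _ _ (fun t => M * f t)).
- exact: measurable_funM.
- move: XM; apply: filterS => t XM; rewrite normrM normrM mulrC.
  by apply: ler_wpM2r => //; rewrite (le_trans XM)// ler_norm.
- rewrite (_ : _ \o _ = (fun t => M%:E * (EFin \o f) t)%E)//.
  exact: integrableZl.
Qed.

Lemma Linf_integrable X : Linf mu A X -> mu.-integrable setT (EFin \o X).
Proof.
move=> LX; have -> : X = (fun t => cst 1 t * X t).
  by apply/funext => t; rewrite mul1r.
apply: integrable_LinfM LX; exact: finite_measure_integrable_cst.
Qed.

End bounded_functions.

Lemma LinfS {d : measure_display} {T : measurableType d} {R : realType}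
    (mu : {measure set T -> \bar R}) (A B : set (set T)) (X : T -> R) :
  A `<=` B -> Linf mu A X -> Linf mu B X.
Proof. by move=> AB [mX bX]; split=> // S /mX /AB. Qed.

(** * Uniqueness and existence of conditional expectations *)

Section conditional_expectation.
Context {d : measure_display} {T : measurableType d} {R : realType}.
Context {A : set (set T)} (sA : sub_sigma A).
Implicit Types (X Y : T -> R) (mu : {measure set T -> \bar R}).

Lemma is_cond_exp_unique mu X Y Y' :
  is_cond_exp mu A X Y -> is_cond_exp mu A X Y' -> Y = Y' %[ae mu].
Proof.
move=> [_ mY iY YE] [_ mY' iY' YE']; apply: (meas_wrt_ae_eq sA) => // G AG.
by rewrite YE// YE'.
Qed.

Lemma eq_ae_is_cond_exp mu X X' Y Y' :
  measurable_fun setT X' -> meas_wrt A Y' ->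
  X = X' %[ae mu] -> Y = Y' %[ae mu] ->
  is_cond_exp mu A X Y -> is_cond_exp mu A X' Y'.
Proof.
move=> mX' mY' XX' YY' [iX mY iY YE].
have mX : measurable_fun setT X by case/integrableP: iX => /measurable_EFinP.
have wmY := meas_wrt_measurable sA mY; have wmY' := meas_wrt_measurable sA mY'.
split=> //; [exact: eq_ae_integrable XX' iX|exact: eq_ae_integrable YY' iY|].
move=> G AG; have mG := sub_sigma_measurable sA AG.
by rewrite -(eq_ae_integral mG wmY wmY' YY') YE// (eq_ae_integral mG mX mX' XX').
Qed.

(** The conditional expectation is the density on [A] of the measure with density [X]. Existence
    matters for uniqueness of [f]: a property of all versions of a conditional expectation says
    something only once a version is available. *)
Lemma is_cond_exp_exists (mu : {finite_measure set T -> \bar R}) X :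
  mu.-integrable setT (EFin \o X) -> {ae mu, forall t, 0 <= X t} ->
  exists Y, is_cond_exp mu A X Y.
Proof.
move=> iX X0.
have mX : measurable_fun setT X by case/integrableP: iX => /measurable_EFinP.
(* The positive part is nonnegative everywhere, so its integral is nonnegative over every set, as
   [radon_nikodym_trace] asks. *)
pose X' := X \max cst 0.
have mX' : measurable_fun setT X' by exact: measurable_maxr.
have XX' : X = X' %[ae mu].
  by move: X0; apply: filterS => t X0 _; rewrite /X' /= max_l.
have X'X : X' = X %[ae mu] by move: XX'; apply: filterS => t ->.
have X'0 t : (0 <= (X' t)%:E)%E by rewrite lee_fin le_max lexx orbT.
have iX' : mu.-integrable setT (EFin \o X') by exact: eq_ae_integrable iX.
have [|||F AF tF|G AG muG|Y [_ mY iY YE]] :=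
    @radon_nikodym_trace _ _ _ _ sA mu (fun G => \int[mu]_(t in G) (X' t)%:E)%E.
- by rewrite integral_set0.
- by move=> G; exact: integral_ge0.
- exact: integrable_fin_num.
- apply: (@semi_sigma_additive_nng_induced _ _ _ mu (EFin \o X')) => //.
  + exact/measurable_EFinP.
  + by move=> n; exact: sub_sigma_measurable (AF n).
  + by apply: bigcup_measurable => n _; exact: sub_sigma_measurable (AF n).
- apply: null_set_integral => //; first exact: sub_sigma_measurable AG.
  exact/measurable_funTS/measurable_EFinP.
exists Y; apply: (@eq_ae_is_cond_exp _ X' _ Y) => //; first exact: aeW.
by split=> // G /YE.
Qed.

End conditional_expectation.

(** * Densities of positive functionals continuous from above *)

Section positive_functional.
Context {d : measure_display} {T : measurableType d} {R : realType}.
Context {mu : {finite_measure set T -> \bar R}}.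
Context {B : set (set T)} (sB : sub_sigma B).
Variable phi : (T -> R) -> R.
Implicit Types X Y : T -> R.

Hypothesis phi_lin : forall (a b : R) X Y, Linf mu B X -> Linf mu B Y ->
  phi (fun t => a * X t + b * Y t) = a * phi X + b * phi Y.
Hypothesis phi_ge0 : forall X, Linf mu B X ->
  {ae mu, forall t, 0 <= X t} -> 0 <= phi X.
Hypothesis phi_cont : forall Xn : nat -> T -> R, (forall n, Linf mu B (Xn n)) ->
  {ae mu, forall t, (forall n, Xn n.+1 t <= Xn n t) /\
                    (fun n => Xn n t) @ \oo --> (0 : R)} ->
  phi (Xn n) @[n --> \oo] --> (0 : R).

Let phi_le X Y : Linf mu B X -> Linf mu B Y ->
  {ae mu, forall t, X t <= Y t} -> phi X <= phi Y.
Proof.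
move=> LX LY XY; rewrite -subr_ge0.
have -> : phi Y - phi X = phi (fun t => 1 * Y t + -1 * X t).
  by rewrite phi_lin// mul1r mulN1r.
apply: phi_ge0; first exact: Linf_lin.
by move: XY; apply: filterS => t XY; rewrite mul1r mulN1r subr_ge0.
Qed.

Let phi_ae X Y : Linf mu B X -> Linf mu B Y -> X = Y %[ae mu] -> phi X = phi Y.
Proof.
move=> LX LY XY; apply/eqP; rewrite eq_le; apply/andP; split; apply: phi_le => //.
- by move: XY; apply: filterS => t ->.
- by move: XY; apply: filterS => t ->.
Qed.

Let phi0 : phi (fun=> 0) = 0.
Proof.
have L0 : Linf mu B (fun=> 0) := Linf_cst sB 0.
have := phi_lin 0 0 L0 L0; rewrite !mul0r addr0; apply: etrans.
by congr phi; apply/funext => t; rewrite mul0r addr0.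
Qed.

Let phi_indic_ge0 G : B G -> 0 <= phi \1_G.
Proof. by move=> BG; apply: phi_ge0; [exact: Linf_indic|exact: aeW]. Qed.

(** The remainders [Xn n], indicators of the union minus its first [n] pieces, decrease pointwise to
    0, so continuity from above sends [phi (Xn n)] to 0. *)
Let phi_sigma_additive (F : nat -> set T) : (forall n, B (F n)) ->
  trivIset setT F ->
  \sum_(0 <= i < n) phi \1_(F i) @[n --> \oo] --> phi \1_(\bigcup_n F n).
Proof.
move=> BF tF; set U := \bigcup_n F n.
have BU : B U.
  rewrite -(trace_measurableE sB); apply: bigcupT_measurable => n.
  by rewrite (trace_measurableE sB).
pose Xn n t : R := \1_U t - \sum_(0 <= i < n) \1_(F i) t.
have XnS n : Xn n.+1 = (fun t => 1 * Xn n t + -1 * \1_(F n) t).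
  by apply/funext => t; rewrite /Xn big_nat_recr//= opprD addrA mul1r mulN1r.
have X0 : Xn 0%N = \1_U by apply/funext => t; rewrite /Xn big_geq// subr0.
have LXn n : Linf mu B (Xn n).
  elim: n => [|n IH]; first by rewrite X0; exact: Linf_indic.
  by rewrite XnS; apply: Linf_lin => //; exact: Linf_indic.
have phiXn n : phi (Xn n) = phi \1_U - \sum_(0 <= i < n) phi \1_(F i).
  elim: n => [|n IH]; first by rewrite X0 big_geq// subr0.
  rewrite XnS phi_lin//; last exact: Linf_indic.
  by rewrite IH big_nat_recr//= mul1r mulN1r opprD addrA.
have : phi (Xn n) @[n --> \oo] --> (0 : R).
  apply: phi_cont => //; apply: aeW => t; split=> [n|].
    by rewrite XnS mul1r mulN1r gerBl.
  have [[k _ Fkt]|nUt] := pselect (U t); last first.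
    rewrite (_ : (fun n => _) = cst 0); first exact: cvg_cst.
    apply/funext => n; rewrite /Xn indicE memNset// big1 ?subr0// => i _.
    by rewrite indicE memNset// => Fit; apply: nUt; exists i.
  (* At a point of [F k] the remainder is 0 as soon as the sum includes index [k]; disjointness
     kills every other term. *)
  apply: cvg_near_cst; exists k.+1 => // n /= kn.
  rewrite /Xn big_mkord (bigD1 (Ordinal kn))//= !indicE !mem_set//; last by exists k.
  rewrite big1 ?addr0 ?subrr// => i ik; rewrite indicE memNset// => Fit.
  move/eqP: ik; apply; apply/val_inj => /=.
  by apply: (tF i k) => //; exists t.
move=> phi0'.
have -> : (fun n => \sum_(0 <= i < n) phi \1_(F i)) =
    (fun n => phi \1_U - phi (Xn n)).
  by apply/funext => n; rewrite phiXn opprB addrC subrK.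
by rewrite -[X in _ --> X]subr0; apply: cvgB => //; exact: cvg_cst.
Qed.

Let phi_density_indic : exists f : T -> R, [/\ forall t, 0 <= f t, meas_wrt B f,
  mu.-integrable setT (EFin \o f) &
  forall G, B G -> phi \1_G = \int[mu]_t (f t * \1_G t)].
Proof.
(* A measure is nonnegative on all sets, but [phi] is only controlled on [B]. *)
pose nu (G : set T) : \bar R := `|phi \1_G|%:E.
have nuE G : B G -> nu G = (phi \1_G)%:E.
  by move=> BG; rewrite /nu ger0_norm// phi_indic_ge0.
have [||||G BG muG|f [f0 mf fi fE]] := @radon_nikodym_trace _ _ _ _ sB mu nu.
- rewrite /nu (_ : \1_set0 = fun=> 0) ?phi0 ?normr0//.
  by apply/funext => t; rewrite indic0.
- by move=> G; rewrite lee_fin.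
- by [].
- move=> F BF tF; rewrite nuE; last first.
    rewrite -(trace_measurableE sB); apply: bigcupT_measurable => n.
    by rewrite (trace_measurableE sB).
  rewrite (_ : (fun n => _) = EFin \o (fun n => \sum_(0 <= i < n) phi \1_(F i))).
    by apply: cvg_EFin; [exact: nearW|exact: phi_sigma_additive].
  apply/funext => n /=; rewrite -sumEFin.
  by apply: eq_bigr => i _; rewrite nuE.
- rewrite nuE//; congr EFin; rewrite -phi0; apply: phi_ae.
  + exact: Linf_indic.
  + exact: Linf_cst.
  + exists G; split=> //; first exact: sub_sigma_measurable BG.
    move=> t /= nt; apply: contrapT => nGt; apply: nt => _.
    by rewrite indicE memNset.
exists f; split=> // G BG; rewrite /Rintegral.
under eq_integral do rewrite mulrC.
by rewrite integral_indicM -fE// nuE.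
Qed.

(** The functionals [phi] and [psi], integration against [f], agree on indicators. Binary expansion
    extends this to functions with values in [0, 1], and an affine rescaling to all bounded
    functions. *)
Lemma positive_functional_density : exists f : T -> R,
  [/\ forall t, 0 <= f t, meas_wrt B f, mu.-integrable setT (EFin \o f) &
      forall X, Linf mu B X -> phi X = \int[mu]_t (f t * X t)].
Proof.
have [f [f0 mf fi fE]] := phi_density_indic; exists f; split=> //.
have wmf := meas_wrt_measurable sB mf.
pose psi X := \int[mu]_t (f t * X t).
have ifX X : Linf mu B X -> mu.-integrable setT (EFin \o (fun t => f t * X t)).
  exact: (integrable_LinfM sB).
have psi_lin (a b : R) X Y : Linf mu B X -> Linf mu B Y ->
    psi (fun t => a * X t + b * Y t) = a * psi X + b * psi Y.
  move=> LX LY; rewrite /psi -!RintegralZl//; [|exact: ifX..].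
  rewrite -RintegralD//.
  - by apply: eq_Rintegral => t _; rewrite mulrDr !mulrA ![_ * f t]mulrC.
  - by rewrite (_ : _ \o _ = (fun t => a%:E * (f t * X t)%:E)%E)//;
      apply: integrableZl => //; exact: ifX.
  - by rewrite (_ : _ \o _ = (fun t => b%:E * (f t * Y t)%:E)%E)//;
      apply: integrableZl => //; exact: ifX.
have psi_ge0 X : (forall t, 0 <= X t) -> 0 <= psi X.
  by move=> X0; apply: Rintegral_ge0 => t _; exact: mulr_ge0.
have psi_ae X Y : Linf mu B X -> Linf mu B Y -> X = Y %[ae mu] -> psi X = psi Y.
  move=> LX LY XY; rewrite /psi /Rintegral; congr fine.
  apply: eq_ae_integral => //; [| |by move: XY; apply: filterS => t ->].
  - by apply: measurable_funM => //; exact: Linf_measurable LX.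
  - by apply: measurable_funM => //; exact: Linf_measurable LY.
have L1 : Linf mu B (fun=> 1) := Linf_cst sB 1.
have ind1 : \1_setT = (fun=> 1) :> (T -> R) by apply/funext => t; rewrite indicT.
have psi1 : phi (fun=> 1) = psi (fun=> 1).
  by rewrite -ind1; apply: fE; exact: sub_sigmaT.
have Linf01 X : meas_wrt B X -> (forall t, 0 <= X t <= 1) -> Linf mu B X.
  move=> mX X01; apply: Linf_le L1 => //; apply: aeW => t.
  by have /andP[X0 X1] := X01 t; rewrite ger0_norm// normr1.
(* Extracting the leading binary digit [D] of X halves the error. *)
have dyadic n X : meas_wrt B X -> (forall t, 0 <= X t <= 1) ->
    `|phi X - psi X| <= phi (fun=> 1) * 2^-1 ^+ n.
  elim: n X => [|n IH] X mX X01; have LX := Linf01 _ mX X01.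
    (* Both [phi X] and [psi X] lie between 0 and the common value of [phi] and [psi] at 1. *)
    rewrite expr0 mulr1 ler_norml; apply/andP; split.
      rewrite lerBrDl.
      have : psi X <= psi (fun=> 1).
        rewrite -subr_ge0.
        have -> : psi (fun=> 1) - psi X = psi (fun t => 1 * 1 + -1 * X t).
          by rewrite psi_lin// mul1r mulN1r.
        apply: psi_ge0 => t; rewrite !mul1r mulN1r subr_ge0.
        by have /andP[] := X01 t.
      rewrite psi1 => psiX; apply: (@le_trans _ _ 0); first by rewrite subr_le0.
      by apply: phi_ge0 => //; apply: aeW => t; have /andP[] := X01 t.
    rewrite lerBlDr; apply: (@le_trans _ _ (phi (fun=> 1))).
      by apply: phi_le => //; apply: aeW => t; have /andP[] := X01 t.
    by rewrite lerDl; apply: psi_ge0 => t; have /andP[] := X01 t.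
  pose D := [set t | 2^-1 <= X t].
  have BD : B D.
    have := mX `[2^-1, +oo[%classic (measurable_itv _).
    by rewrite /D /preimage/= (_ : [set t | _ ] = [set t | 2^-1 <= X t])//;
      apply/funext => t /=; rewrite in_itv/= andbT.
  have LD : Linf mu B (\1_D : T -> R) := Linf_indic sB BD.
  pose X' t := 2 * X t + -1 * \1_D t.
  have LX' : Linf mu B X' := Linf_lin sB 2 (-1) LX LD.
  have X'01 t : 0 <= X' t <= 1.
    have /andP[X0 X1] := X01 t; rewrite /X' indicE.
    have [Dt|nDt] := pselect (D t).
      by rewrite mem_set//; move: Dt; rewrite /D/=; lra.
    by rewrite memNset//; move/negP: nDt; rewrite /D/= -ltNge; lra.
  have XE : X = (fun t => 2^-1 * X' t + 2^-1 * \1_D t).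
    by apply/funext => t; rewrite /X'; lra.
  (* The contributions of [D] cancel, which leaves half the error of [X'], again a function with
     values in [0, 1]. *)
  rewrite XE phi_lin// psi_lin// (fE _ BD) -/(psi \1_D).
  rewrite opprD addrACA subrr addr0 -mulrBr normrM ger0_norm ?invr_ge0//.
  by rewrite exprS mulrCA ler_pM2l ?invr_gt0//; apply: IH => //; case: LX'.
have E01 X : meas_wrt B X -> (forall t, 0 <= X t <= 1) -> phi X = psi X.
  move=> mX X01; apply/eqP; rewrite -subr_eq0 -normr_le0.
  have half : `|2^-1 : R| < 1 by rewrite ger0_norm ?invr_ge0// invf_lt1// ltr1n.
  apply: (ler_cvg_to (cvg_cst _) (cvg_geometric (phi (fun=> 1)) half)).
  by apply: nearW => n; exact: dyadic.
move=> X LX; have [mX [M XM]] := LX; pose M' := `|M| + 1.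
have M'0 : 0 < M' by rewrite ltr_pwDr.
(* The affine map sends [-M', M'] onto [0, 1]. Since [X] is bounded only a.e., truncation secures
   the bounds at every point, as [E01] requires. *)
pose Z t := Num.max 0 (Num.min 1 ((2 * M')^-1 * X t + 2^-1 * 1)).
have Z01 t : 0 <= Z t <= 1.
  by rewrite /Z le_max lexx/= ge_max ler01 ge_min lexx.
have mZ : meas_wrt B Z.
  apply/(meas_wrtP sB)/measurable_maxr => //; apply: measurable_minr => //.
  by have [/(meas_wrtP sB)] := Linf_lin sB (2 * M')^-1 2^-1 LX L1.
have LZ := Linf01 _ mZ Z01.
have LZ' := Linf_lin sB (2 * M') (- M') LZ L1.
have XZ : X = (fun t => 2 * M' * Z t + - M' * 1) %[ae mu].
  move: XM; apply: filterS => t XM _; rewrite /Z.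
  have : `|X t| <= M' by rewrite (le_trans XM)// (le_trans (ler_norm _))// lerDl.
  rewrite ler_norml => /andP[X0 X1].
  have -> : (2 * M')^-1 * X t + 2^-1 * 1 = (2 * M')^-1 * (X t + M').
    by field; rewrite gt_eqF.
  rewrite min_r ?max_r; last 2 first.
  - by rewrite mulr_ge0// ?invr_ge0; lra.
  - by rewrite ler_pdivrMl ?mulr_gt0// mulr1; lra.
  by field; rewrite gt_eqF.
rewrite (phi_ae LX LZ' XZ) -/(psi X) (psi_ae _ _ LX LZ' XZ).
by rewrite phi_lin// psi_lin// E01// psi1.
Qed.

End positive_functional.

(** * The normalized operator as a conditional expectation *)

Section operator.
Context {d : measure_display} {T : measurableType d} {R : realType}.
Context {P : {finite_measure set T -> \bar R}}.
Context {A B : set (set T)} (sA : sub_sigma A) (sB : sub_sigma B).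
Hypothesis AB : A `<=` B.
Variables (x : (T -> R) -> T -> R) (c : R).
Hypotheses (x_maps : op_maps P A B x) (x_lin : op_linear P B x).
Hypotheses (x_hom : op_homogeneous P A B x) (x_mono : op_monotone P B x).
Hypotheses (x_cont : op_cont_above P B x) (c_gt0 : 0 < c).
Hypothesis x1_ge : {ae P, forall t, c <= x (fun=> 1) t}.
Implicit Types X Y : T -> R.

Definition normalized X t : R := x X t / x (fun=> 1) t.

Let L0 : Linf P B (fun=> 0) := Linf_cst sB 0.
Let L1 : Linf P B (fun=> 1) := Linf_cst sB 1.

Lemma normalized_Linf X : Linf P B X -> Linf P A (normalized X).
Proof.
move=> LX; have [mX _] := x_maps LX; have [m1 _] := x_maps L1.
(* As [x 1 >= c] a.e., division by it enlarges absolute values by at most the factor [c^-1]; the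
   zero term only gives the bound the shape of [Linf_lin]. *)
apply: (@Linf_le _ _ _ _ _ _ (fun t => c^-1 * x X t + 0 * x X t)).
- apply/(meas_wrtP sA); apply: measurable_funM; first exact/(meas_wrtP sA).
  by apply: measurable_fun_invr; exact/(meas_wrtP sA).
- move: x1_ge; apply: filterS => t cx1.
  have x1_gt0 : 0 < x (fun=> 1) t by exact: lt_le_trans cx1.
  rewrite mul0r addr0 /normalized [X in `|X| <= _]mulrC !normrM ler_wpM2r//.
  by rewrite !normfV !gtr0_norm// lef_pV2.
- by apply: Linf_lin => //; exact: x_maps.
Qed.

Lemma normalizedK X : Linf P B X ->
  x X = (fun t => x (fun=> 1) t * normalized X t) %[ae P].
Proof.
move=> LX; move: x1_ge; apply: filterS => t cx1 _.
by rewrite /normalized mulrC divfK// gt_eqF// (lt_le_trans c_gt0).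
Qed.

Lemma normalized1 : normalized (fun=> 1) = cst 1 %[ae P].
Proof.
move: x1_ge; apply: filterS => t cx1 _.
by rewrite /normalized divff// gt_eqF// (lt_le_trans c_gt0).
Qed.

Let normalized_measurable X : Linf P B X -> measurable_fun setT (normalized X).
Proof. by move=> /normalized_Linf; exact: Linf_measurable. Qed.

Let normalized_integrable X :
  Linf P B X -> P.-integrable setT (EFin \o normalized X).
Proof. by move=> /normalized_Linf; exact: Linf_integrable. Qed.

Let x0 : x (fun=> 0) = cst 0 %[ae P].
Proof.
have := x_lin 0 0 L0 L0.
rewrite [X in x X](_ : _ = fun=> 0); last first.
  by apply/funext => t; rewrite mul0r addr0.
by apply: filterS => t /[apply]; rewrite !mul0r addr0.
Qed.

Let normalized_ge0 X : Linf P B X -> {ae P, forall t, 0 <= X t} ->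
  {ae P, forall t, 0 <= normalized X t}.
Proof.
move=> LX X0; have xX0 := x_mono LX L0 X0.
move: xX0 x0 x1_ge; apply: filterS3 => t + /(_ I) x0t cx1.
by rewrite x0t => xX0; rewrite divr_ge0// (le_trans (ltW c_gt0)).
Qed.

Let phi X := \int[P]_t normalized X t.

Let phi_lin (a b : R) X Y : Linf P B X -> Linf P B Y ->
  phi (fun t => a * X t + b * Y t) = a * phi X + b * phi Y.
Proof.
move=> LX LY; have LZ := Linf_lin sB a b LX LY.
have iX := normalized_integrable LX; have iY := normalized_integrable LY.
have mX := normalized_measurable LX; have mY := normalized_measurable LY.
rewrite /phi -!RintegralZl// -RintegralD//.
- rewrite /Rintegral; congr fine; apply: eq_ae_integral => //.
  + exact: normalized_measurable.
  + by apply: measurable_funD; apply: measurable_funM.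
  + have := x_lin a b LX LY; apply: filterS => t /[apply] xE.
    by rewrite /normalized xE mulrDl !mulrA.
- exact: (integrableZl measurableT a iX).
- exact: (integrableZl measurableT b iY).
Qed.

Let phi_ge0 X : Linf P B X -> {ae P, forall t, 0 <= X t} -> 0 <= phi X.
Proof.
move=> LX X0; have mX := normalized_measurable LX.
(* The integrand is nonnegative only a.e.; its absolute value is so at every point and has the same
   integral. *)
have -> : phi X = \int[P]_t `|normalized X t|.
  rewrite /phi /Rintegral; congr fine; apply: eq_ae_integral => //.
    exact: (measurableT_comp (@normr_measurable _ _)).
  have := normalized_ge0 LX X0; apply: filterS => t X'0 _.
  by rewrite ger0_norm.
exact: Rintegral_ge0.
Qed.

(** Dominated convergence: a.e. [x (Xn n)] decreases to 0, hence stays between 0 and [x (Xn 0)], and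
    [normalized (Xn 0)] is an integrable bound. *)
Let phi_cont (Xn : nat -> T -> R) : (forall n, Linf P B (Xn n)) ->
  {ae P, forall t, (forall n, Xn n.+1 t <= Xn n t) /\
                   (fun n => Xn n t) @ \oo --> (0 : R)} ->
  phi (Xn n) @[n --> \oo] --> (0 : R).
Proof.
move=> LXn Xn0; have xXn := x_cont LXn L0 Xn0.
have {}xXn : {ae P, forall t, (forall n, 0 <= x (Xn n) t <= x (Xn 0%N) t) /\
    (fun n => x (Xn n) t) @ \oo --> (0 : R)}.
  move: xXn x0; apply: filterS2 => t [xXd xXc] /(_ I) x0t.
  have {}xXc : (fun n => x (Xn n) t) @ \oo --> (0 : R) by rewrite x0t in xXc.
  split=> // n.
  have nd : nonincreasing_seq (fun n => x (Xn n) t).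
    by apply/nonincreasing_seqP.
  rewrite nd// andbT; rewrite -[leLHS](cvg_lim _ xXc)//.
  by apply: nonincreasing_cvgn_ge => //; apply/cvg_ex; exists 0.
have LX0 := LXn 0%N.
have [| |_ _] := @dominated_convergence _ _ _ P setT measurableT
  (fun n => EFin \o normalized (Xn n)) (cst 0%E) (EFin \o normalized (Xn 0%N))
  (fun n => (measurable_EFinP _ _).2 (normalized_measurable (LXn n)))
  (measurable_cst _) _ (normalized_integrable LX0) _.
- move: xXn; apply: filterS => t [_ xXc] _ /=.
  apply: cvg_EFin; first exact: nearW.
  by rewrite -(mul0r (x (fun=> 1) t)^-1); apply: cvgMl.
- move: xXn x1_ge; apply: filterS2 => t [xXb _] cx1 n _ /=.
  have x1_ge0 : 0 <= (x (fun=> 1) t)^-1.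
    by rewrite invr_ge0 (le_trans (ltW c_gt0)).
  have /andP[Xn_ge0 XnX0] := xXb n.
  by rewrite lee_fin ger0_norm ?mulr_ge0// ler_wpM2r.
by rewrite integral0 => /fine_cvg.
Qed.

(* Homogeneity in the indicators of [A] localizes the single functional
   [X |-> \int x X / x 1] to every event of [A]. *)
Lemma normalized_cond_exp : exists f : T -> R,
  [/\ forall t, 0 <= f t, meas_wrt B f, P.-integrable setT (EFin \o f) &
      forall X, Linf P B X ->
        is_cond_exp P A (fun t => f t * X t) (normalized X)].
Proof.
have [f [f0 mf fi fE]] := positive_functional_density sB phi_lin phi_ge0 phi_cont.
exists f; split=> // X LX.
have ifX Y : Linf P B Y -> P.-integrable setT (EFin \o (fun t => f t * Y t)).
  exact: (integrable_LinfM sB).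
split; [exact: ifX|by case: (normalized_Linf LX)|exact: normalized_integrable|].
move=> G AG; have LG := Linf_indic (mu := P) sA AG.
have LGX : Linf P B (fun t => \1_G t * X t).
  by apply: LinfM => //; exact: LinfS AB LG.
have iG := normalized_integrable LGX.
rewrite -integral_indicM -[RHS]integral_indicM.
transitivity (\int[P]_t (normalized (fun t => \1_G t * X t) t)%:E)%E.
  apply/esym; apply: eq_ae_integral => //.
  - exact: normalized_measurable.
  - apply: measurable_funM; last exact: normalized_measurable.
    exact: Linf_measurable LG.
  - have := x_hom LG (aeW P (fun t => ler0n R (t \in G))) LX.
    apply: filterS => t /(_ I) xE _.
    by rewrite /normalized xE mulrA.
have := congr1 (@EFin R) (fE _ LGX); rewrite /phi /Rintegral !fineK ?integrable_fin_num//; last exact: ifX.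
by move=> ->; apply: eq_integral => t _; rewrite mulrCA.
Qed.

End operator.

(** * Probability measures given by a density *)

Section density.
Context {d : measure_display} {T : measurableType d} {R : realType}.
Implicit Types (P Q : probability T R) (f X : T -> R).

Lemma density_probability P f : measurable_fun setT f -> (forall t, 0 <= f t) ->
  (\int[P]_t (f t)%:E = 1)%E ->
  exists Q : probability T R, forall G, Q G = (\int[P]_(t in G) (f t)%:E)%E.
Proof.
move=> mf f0 f1; pose q (G : set T) := (\int[P]_(t in G) (f t)%:E)%E.
have q0 : q set0 = 0%E by exact: integral_set0.
have q_ge0 G : (0 <= q G)%E by apply: integral_ge0 => t _; rewrite lee_fin.
have q_sigma : semi_sigma_additive q.
  apply: (@semi_sigma_additive_nng_induced _ _ _ P (EFin \o f)) => //.
  exact/measurable_EFinP.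
pose mq : {measure set T -> \bar R} :=
  HB.pack q (isMeasure.Build _ _ _ q q0 q_ge0 q_sigma).
pose Q : probability T R :=
  HB.pack q (Measure.on mq) (Measure_isProbability.Build _ _ _ mq f1).
by exists Q.
Qed.

(** Change of variables holds with the Radon-Nikodym derivative [D]; it has the same integral as [f]
    over every event, so the two agree a.e. *)
Lemma integral_density P Q f X G : P.-integrable setT (EFin \o f) ->
  (forall E, measurable E -> Q E = (\int[P]_(t in E) (f t)%:E)%E) ->
  Q.-integrable setT (EFin \o X) -> measurable G ->
  (\int[Q]_(t in G) (X t)%:E = \int[P]_(t in G) (f t * X t)%:E)%E.
Proof.
move=> fi QE Xi mG.
have mf : measurable_fun setT f by case/integrableP: fi => /measurable_EFinP.
have mX : measurable_fun setT X by case/integrableP: Xi => /measurable_EFinP.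
have QP : Q `<< P.
  apply/null_content_dominatesP => E mE PE; rewrite QE//.
  apply: null_set_integral => //; exact/measurable_funTS/measurable_EFinP.
pose D := Radon_Nikodym (charge_of_finite_measure Q) P.
have Di : P.-integrable setT D by exact: Radon_Nikodym_integrable.
have Df : ae_eq P setT D (EFin \o f).
  apply: integral_ae_eq => //; first exact/measurable_EFinP.
  by move=> E _ mE; rewrite -Radon_Nikodym_integral// -QE.
rewrite -(Radon_Nikodym_change_of_variables QP mG); last exact: integrableS Xi.
apply: ae_eq_integral => //.
- apply/measurable_funTS/emeasurable_funM; first exact/measurable_EFinP.
  exact: measurable_int Di.
- by apply/measurable_funTS/measurable_EFinP/measurable_funM.
- by move: Df; apply: filterS => t /(_ I) Dt _; rewrite -/D Dt muleC.
Qed.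

End density.

(** * Both representations of the operator, and uniqueness of the normalized density *)

Theorem theorem3p3 (d : measure_display) (T : measurableType d) (R : realType)
    (P : probability T R) (A B : set (set T))
    (x : (T -> R) -> T -> R) (c : R) :
  measure_is_complete P ->
  sub_sigma A -> sub_sigma B -> A `<=` B ->
  op_maps P A B x -> op_respects_ae P B x ->
  op_linear P B x -> op_homogeneous P A B x -> op_monotone P B x ->
  op_cont_above P B x ->
  0 < c -> {ae P, forall t, c <= x (fun=> 1) t} ->
  (exists (Q : probability T R) (f : T -> R),
     [/\ L1plus P B f,
         (forall G, B G -> P G = 0%E -> Q G = 0%E),
         (forall G, B G -> Q G = (\int[P]_(t in G) (f t)%:E)%E) &
         forall X, Linf P B X ->
           (forall Y, is_cond_exp Q A X Y ->
              x X = (fun t => x (fun=> 1) t * Y t) %[ae P]) /\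
           (forall g, is_cond_exp P A f g ->
            forall Z, is_cond_exp P A (fun t => X t * (f t / g t)) Z ->
              x X = (fun t => x (fun=> 1) t * Z t) %[ae P])])
  /\
  (exists f : T -> R,
     [/\ L1plus P B f, is_cond_exp P A f (fun=> 1),
         (forall X, Linf P B X ->
            forall Y, is_cond_exp P A (fun t => f t * X t) Y ->
              x X = (fun t => x (fun=> 1) t * Y t) %[ae P]) &
         forall f' : T -> R,
           L1plus P B f' -> is_cond_exp P A f' (fun=> 1) ->
           (forall X, Linf P B X ->
              forall Y, is_cond_exp P A (fun t => f' t * X t) Y ->
                x X = (fun t => x (fun=> 1) t * Y t) %[ae P]) ->
           f' = f %[ae P]]).
Proof.
move=> _ sA sB AB x_maps _ x_lin x_hom x_mono x_cont c_gt0 x1_ge.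
have L1 : Linf P B (fun=> 1) := Linf_cst sB 1.
have [f [f0 mf fi fE]] :=
  normalized_cond_exp sA sB AB x_maps x_lin x_hom x_mono x_cont c_gt0 x1_ge.
(* Each representation thus reduces to identifying a conditional expectation with
   [normalized x X]. *)
have xK X : Linf P B X -> forall Y, Y = normalized x X %[ae P] ->
    x X = (fun t => x (fun=> 1) t * Y t) %[ae P].
  move=> LX Y; have := normalizedK c_gt0 x1_ge LX.
  by apply: filterS2 => t /(_ I) xE /(_ I) YE _; rewrite xE YE.
have wmf := meas_wrt_measurable sB mf.
have m1 : meas_wrt A (fun=> 1 : R) by case: (Linf_cst (mu := P) sA 1).
(* This is the identity [fE] at the constant 1, whose normalized image is 1 a.e. *)
have f1 : is_cond_exp P A f (fun=> 1).
  apply: (eq_ae_is_cond_exp sA _ _ _ _ (fE _ L1)) => //.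
  - by apply: aeW => t _; rewrite mulr1.
  - exact: normalized1 c_gt0 x1_ge.
have Lf : L1plus P B f by split=> //; exact: aeW.
have fmX X : Linf P B X -> measurable_fun setT (fun t => f t * X t).
  by move=> LX; apply: measurable_funM => //; exact: Linf_measurable LX.
have intf G : A G -> (\int[P]_(t in G) (f t)%:E = P G)%E.
  move=> AG; have [_ _ _ <-//] := f1.
  have mG := sub_sigma_measurable sA AG.
  by rewrite integral_cst// mul1e.
split.
  (* [Q] is built on the whole sigma-algebra of [T]; its restriction to [B] is the measure
     sought. *)
  have [Q QE] : exists Q : probability T R,
      forall G, Q G = (\int[P]_(t in G) (f t)%:E)%E.
    apply: density_probability => //.
    by rewrite intf ?probability_setT//; exact: sub_sigmaT sA.
  have QP G : A G -> Q G = P G by move=> AG; rewrite QE intf.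
  exists Q, f; split=> //.
    move=> G BG PG; rewrite QE; have mG := sub_sigma_measurable sB BG.
    by apply: null_set_integral => //; exact/measurable_funTS/measurable_EFinP.
  move=> X LX; split.
    move=> Y [iX mY iY YE]; apply: xK => //.
    (* For [G] in [A], the integral of [Y] over [G] is the same under [P] and [Q]; under [Q] it is
       that of [X], hence that of [f X] under [P]. *)
    have [iY' YE'] := eq_measure_meas_wrt sA mY QP iY.
    apply: (is_cond_exp_unique sA (X := fun t => f t * X t)) (fE _ LX).
    split=> //; first by case: (fE _ LX).
    move=> G AG; rewrite YE'// YE// (integral_density fi)//.
    exact: sub_sigma_measurable AG.
  move=> g fg Z ZE; apply: xK => //.
  (* Any version [g] of [E[f | A]] is 1 a.e., so [f / g] is [f] a.e. *)
  have g1 := is_cond_exp_unique sA fg f1.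
  apply: (is_cond_exp_unique sA) (fE _ LX).
  apply: (eq_ae_is_cond_exp sA _ _ _ _ ZE) => //.
  - exact: fmX.
  - by case: ZE.
  - move: g1; apply: filterS => t /(_ I) -> _.
    by rewrite divr1 mulrC.
  - exact: aeW.
exists f; split=> //.
  by move=> X LX Y YE; apply: xK => //; apply: (is_cond_exp_unique sA YE (fE _ LX)).
move=> f' [mf' f'i f'0] _ xf'.
(* It suffices to compare the integrals of [f'] and [f] over each [G] in [B]. Both equal the total
   integral of [normalized x] at the indicator of [G], a version of either conditional expectation
   once [x 1] is cancelled. *)
apply: (meas_wrt_ae_eq sB) => // G BG.
have LG : Linf P B \1_G := Linf_indic sB BG.
have [Y YE] : exists Y, is_cond_exp P A (fun t => f' t * \1_G t) Y.
  apply: (is_cond_exp_exists sA); first exact: (integrable_LinfM sB).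
  by move: f'0; apply: filterS => t f't; rewrite mulr_ge0.
have fY : Y = normalized x \1_G %[ae P].
  move: (xf' _ LG _ YE) (normalizedK c_gt0 x1_ge LG) (x1_ge).
  apply: filterS3 => t /(_ I) -> /(_ I) xE cx1 _.
  have x1_neq0 : x (fun=> 1) t != 0 by rewrite gt_eqF// (lt_le_trans c_gt0).
  exact: (mulfI x1_neq0).
have [_ mY iY YT] := YE; have [_ mN iN NT] := fE _ LG.
have AT := sub_sigmaT sA.
rewrite -(integral_indicM P f' G) -(integral_indicM P f G).
under eq_integral do rewrite mulrC; rewrite -YT//.
under [RHS]eq_integral do rewrite mulrC; rewrite -NT//.
by apply: eq_ae_integral => //; apply: (meas_wrt_measurable sA).
Qed.
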